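(* Let $A$ be a semiprime algebra over an infinite commutative domain $R$. If the group of units $U(A)$ satisfies a Laurent polynomial identity over $R$, then every idempotent element of $R^{-1}A$ is central, and for all $b,c\in A$ such that $bc=0$ we have $bac=0$ for every nilpotent element $a$ of $A$.
   Context: Algebras are associative with unit; $U(A)$ is the group of units of $A$. $R^{-1}A$ denotes the ring of fractions of $A$ with respect to the non-zero elements of $R$. Let $F=\langle x_1,\dots,x_m\rangle$ be a free group. A Laurent polynomial identity (LPI) over $R$ for $U(A)$ is a non-zero element $P$ of the group ring $RF$ such that $P(c_1,\dots,c_m)=0$ in $A$ for all $c_1,\dots,c_m\in U(A)$. Throughout, an LPI is assumed to be of the form $P=a_1+a_2w_2+\cdots+a_tw_t$ with $t\ge 2$, all $a_i\in R$ non-zero (in particular $a_1\neq 0$), and $w_2,\dots,w_t$ distinct non-trivial words in $F$, such that each $w_i$ has non-zero sum of exponents in at least one of the variables $x_j$.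
   Formalization: The second conclusion (bac=0) is stated only for A torsion-free over R; without this it fails, e.g. for R=Z, A=M_2(F_2), the identity 1-x^6, b=e11, c=e22, a=e12. The first conclusion needs no such assumption. *)

(* Defs.v *)
From HB Require Import structures.
From mathcomp Require Import all_boot all_algebra finmap ring.
From mathcomp Require Import boolp classical_sets cardinality.
From mathcomp.multinomials Require Import monalg.

Set Implicit Arguments.
Unset Strict Implicit.
Unset Printing Implicit Defensive.

Import GRing.Theory.

Local Open Scope quotient_scope.
Local Open Scope ring_scope.

(* The free group on x_0, ..., x_(m-1), as reduced words.  The letter         *)
(* (i, true) stands for x_i and (i, false) for x_i^-1.                        *)

Section FreeGroup.
Variable m : nat.

Definition letter := ('I_m * bool)%type.

Definition flip (x : letter) : letter := (x.1, ~~ x.2).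

Definition reduced (w : seq letter) : bool :=
  sorted (fun x y => y != flip x) w.

Record free_group := FreeGroup { word :> seq letter; _ : reduced word }.

HB.instance Definition _ := [isSub for word].
HB.instance Definition _ := [Choice of free_group by <:].

Definition consr (x : letter) (w : seq letter) : seq letter :=
  if w is y :: w' then if y == flip x then w' else x :: w else [:: x].

Definition catr (u v : seq letter) : seq letter := foldr consr v u.

Definition invr (u : seq letter) : seq letter := rev (map flip u).

Lemma flipK : involutive flip.
Proof. by case=> i b; rewrite /flip /= negbK. Qed.

Lemma reduced_consr x w : reduced w -> reduced (consr x w).
Proof.
case: w => [|y w] //=; case: ifP => [_|xy]; first exact: path_sorted.
by move=> /= ->; rewrite xy.
Qed.

Lemma consrK x w : reduced w -> consr (flip x) (consr x w) = w.
Proof.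
case: w => [|y w] /=; first by rewrite flipK eqxx.
case: ifP => [/eqP -> |xy _] /=; last by rewrite flipK eqxx.
by case: w => [|z w] //= /andP[/negPf -> _].
Qed.

Lemma consrVK x w : reduced w -> consr x (consr (flip x) w) = w.
Proof. by move=> /(consrK (flip x)); rewrite flipK. Qed.

Lemma reduced_catr u v : reduced v -> reduced (catr u v).
Proof. by move=> rv; elim: u => //= x u /reduced_consr; apply. Qed.

Lemma catr_consr x u v :
  reduced v -> catr (consr x u) v = consr x (catr u v).
Proof.
move=> rv; case: u => [|y u] //=; case: ifP => [/eqP ->|//].
by rewrite consrVK // reduced_catr.
Qed.

Lemma catrA u v w : reduced w -> catr u (catr v w) = catr (catr u v) w.
Proof. by move=> rw; elim: u => //= x u ->; rewrite catr_consr. Qed.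

Lemma catr0 u : reduced u -> catr u [::] = u.
Proof.
elim: u => //= x u IH pu; rewrite IH; last exact: path_sorted pu.
by case: u pu {IH} => [|y u] //= /andP[/negPf ->].
Qed.

Lemma catVr u w : reduced w -> catr (invr u) (catr u w) = w.
Proof.
move=> rw; elim: u => //= x u IH.
rewrite /invr /= rev_cons -cats1 /catr foldr_cat /= -/(catr u w).
by rewrite consrK ?reduced_catr.
Qed.

Lemma invrK : involutive invr.
Proof.
move=> u; rewrite /invr map_rev revK -map_comp map_id_in // => x _ /=.
exact: flipK.
Qed.

Lemma reduced_invr u : reduced u -> reduced (invr u).
Proof.
rewrite /reduced /invr rev_sorted sorted_map; apply: sub_sorted => x y /=.
by apply: contra => /eqP ->; rewrite flipK.
Qed.

Definition fg_one : free_group := @FreeGroup [::] isT.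

Definition fg_mul (u v : free_group) : free_group :=
  FreeGroup (reduced_catr u (valP v)).

Definition fg_inv (u : free_group) : free_group :=
  FreeGroup (reduced_invr (valP u)).

Fact fg_mulA : associative fg_mul.
Proof. by move=> u v w; apply: val_inj; apply: catrA; apply: valP. Qed.

Fact fg_mul1 : left_id fg_one fg_mul.
Proof. by move=> u; apply: val_inj. Qed.

Fact fg_mulr1 : right_id fg_one fg_mul.
Proof. by move=> u; apply: val_inj; apply: catr0; apply: valP. Qed.

Fact fg_mulV : left_inverse fg_one fg_inv fg_mul.
Proof.
move=> u; apply: val_inj => /=.
by rewrite -{2}(catr0 (valP u)) catVr.
Qed.

Fact fg_mulrV : right_inverse fg_one fg_inv fg_mul.
Proof.
move=> u; apply: val_inj => /=.
by rewrite -{1}(invrK u) -{2}(catr0 (reduced_invr (valP u))) catVr.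
Qed.

HB.instance Definition _ :=
  isGroup.Build free_group fg_mulA fg_mul1 fg_mulr1 fg_mulV fg_mulrV.

Definition exponent_sum (j : 'I_m) (w : free_group) : int :=
  \sum_(x <- word w | x.1 == j) (if x.2 then 1 else -1).

Section Eval.
Variable A : unitRingType.

Definition letter_eval (c : 'I_m -> A) (x : letter) : A :=
  if x.2 then c x.1 else (c x.1)^-1.

Definition word_eval (c : 'I_m -> A) (w : free_group) : A :=
  \prod_(x <- word w) letter_eval c x.

Lemma word_evalM (c : 'I_m -> A) :
  (forall i, c i \is a GRing.unit) ->
  {morph word_eval c : u v / (u * v)%g >-> u * v}.
Proof.
move=> cU [u ru] [v rv]; rewrite /word_eval /= => {ru}.
elim: u => [|x u IH] /=; first by rewrite big_nil mul1r.
rewrite big_cons -mulrA -IH; case: (catr u v) => [|y w] /=.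
  by rewrite big_cons.
case: ifP => [/eqP ->|_]; last by rewrite big_cons.
rewrite big_cons mulrA /letter_eval /=.
by case: x.2 => /=; rewrite ?mulrV ?mulVr ?mul1r.
Qed.

End Eval.
End FreeGroup.

(* Elements of the group ring RF are the finitely supported functions         *)
(* F -> R.  monalg has a product on {malg R[K]} only for K without nontrivial *)
(* units; the notions below use the R-module structure of RF alone.           *)
Definition group_ring (R : nzRingType) (m : nat) := {malg R[free_group m]}.

Section LaurentPolynomialIdentity.
Variables (R : comNzRingType) (m : nat).

Definition laurent_eval (A : unitAlgType R) (c : 'I_m -> A)
    (P : group_ring R m) : A :=
  mmap (in_alg A) (word_eval c) P.

Definition is_LPI (A : unitAlgType R) (P : group_ring R m) : Prop :=
  P != 0 /\
  forall c : 'I_m -> A,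
    (forall i, c i \is a GRing.unit) -> laurent_eval c P = 0.

(* P = a_1 + a_2 w_2 + ... + a_t w_t where t = #|` msupp P|, the a_i are the  *)
(* nonzero coefficients and 1, w_2, ..., w_t are the elements of msupp P.     *)
Definition LPI_normal_form (P : group_ring R m) : Prop :=
  [/\ 1%g \in msupp P,
      (2 <= #|` msupp P|)%N
    & forall w : free_group m, w \in msupp P -> w != 1%g ->
        exists j : 'I_m, exponent_sum j w != 0].

End LaurentPolynomialIdentity.

Definition units_satisfy_LPI (R : comNzRingType) (A : unitAlgType R) : Prop :=
  exists (m : nat) (P : group_ring R m), LPI_normal_form P /\ is_LPI A P.

Section Semiprime.
Local Open Scope classical_set_scope.
Variable A : nzRingType.

Definition two_sided_ideal (I : set A) : Prop :=
  [/\ I 0,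
      forall x y, I x -> I y -> I (x + y)
    & forall a x, I x -> I (a * x) /\ I (x * a)].

(* I ^ n = 0 says that any product of n elements of I is zero. *)
Definition nilpotent_ideal (I : set A) : Prop :=
  exists n : nat, forall x : 'I_n -> A,
    (forall i, I (x i)) -> \prod_(i < n) x i = 0.

Definition semiprime : Prop :=
  forall I : set A, two_sided_ideal I -> nilpotent_ideal I -> I `<=` [set 0].

End Semiprime.

Definition nilpotent (A : nzRingType) (a : A) : Prop := exists n, a ^+ n = 0.

Definition torsion_free (R : nzRingType) (V : lmodType R) : Prop :=
  forall (r : R) (v : V), r *: v = 0 -> r = 0 \/ v = 0.

(* The ring of fractions R^-1 A with respect to the nonzero elements of R.    *)
(* The annihilating factor u in the equivalence makes it the localization     *)
(* also when A has R-torsion, in which case A -> R^-1 A is not injective and  *)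
(* R^-1 A may even be the zero ring.                                          *)

Section Fractions.
Variables (R : idomainType) (A : algType R).

Record prefrac := Prefrac { pf_val :> A * R; _ : pf_val.2 != 0 }.

HB.instance Definition _ := [isSub for pf_val].
HB.instance Definition _ := [Choice of prefrac by <:].


Definition fequiv (x y : prefrac) : bool :=
  `[< exists2 u : R, u != 0 & u *: (y.2 *: x.1) = u *: (x.2 *: y.1) >].

Fact fequiv_refl : reflexive fequiv.
Proof. by move=> x; apply/asboolP; exists 1; rewrite ?oner_neq0. Qed.

Fact fequiv_sym : symmetric fequiv.
Proof.
by move=> x y; apply/asboolP/asboolP => -[u u0 e]; exists u; rewrite ?e.
Qed.

Fact fequiv_trans : transitive fequiv.
Proof.
move=> y x z /asboolP[t t0 xy] /asboolP[u u0 yz]; apply/asboolP.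
exists (t * u * y.2) => [|]; first by rewrite !mulf_neq0 // (valP y).
have -> : (t * u * y.2) *: (z.2 *: x.1) = (u * z.2) *: (t *: (y.2 *: x.1)).
  by rewrite !scalerA; congr (_ *: _); ring.
rewrite xy; have -> : (u * z.2) *: (t *: (x.2 *: y.1)) =
    (t * x.2) *: (u *: (z.2 *: y.1)).
  by rewrite !scalerA; congr (_ *: _); ring.
by rewrite yz !scalerA; congr (_ *: _); ring.
Qed.

Canonical fequiv_equiv := EquivRel fequiv fequiv_refl fequiv_sym fequiv_trans.

Definition fractions := {eq_quot fequiv}.

HB.instance Definition _ : EqQuotient _ fequiv fractions :=
  EqQuotient.on fractions.
HB.instance Definition _ := Choice.on fractions.

Definition frac (a : A) (s : R) (s0 : s != 0) : fractions :=
  \pi_fractions (@Prefrac (a, s) s0).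

Definition num (q : fractions) : A := (repr q).1.
Definition den (q : fractions) : R := (repr q).2.

Lemma den_neq0 q : den q != 0.
Proof. exact: valP (repr q). Qed.

Lemma frac_num_den q : frac (num q) (den_neq0 q) = q.
Proof.
rewrite -[RHS]reprK /frac; congr \pi; apply: val_inj.
by rewrite /= /num /den -surjective_pairing.
Qed.

Lemma eq_frac a s (s0 : s != 0) b t (t0 : t != 0) :
  frac a s0 = frac b t0 <->
  exists2 u : R, u != 0 & u *: (t *: a) = u *: (s *: b).
Proof. by split=> [/eqmodP/asboolP|h]; last exact/eqmodP/asboolP. Qed.

Definition fzero : fractions := frac 0 (oner_neq0 R).
Definition fone : fractions := frac 1 (oner_neq0 R).
Definition fopp (p : fractions) : fractions := frac (- num p) (den_neq0 p).
Definition fadd (p q : fractions) : fractions :=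
  frac (den q *: num p + den p *: num q) (mulf_neq0 (den_neq0 p) (den_neq0 q)).
Definition fmul (p q : fractions) : fractions :=
  frac (num p * num q) (mulf_neq0 (den_neq0 p) (den_neq0 q)).

Lemma frac_repr a s (s0 : s != 0) (q : fractions) : q = frac a s0 ->
  exists2 u : R, u != 0 & (u * s) *: num q = (u * den q) *: a.
Proof.
by rewrite -{1}(frac_num_den q) => /eq_frac[u u0]; rewrite !scalerA; exists u.
Qed.

Lemma foppE a s (s0 : s != 0) : fopp (frac a s0) = frac (- a) s0.
Proof.
apply/eq_frac; have [u u0 e] := frac_repr (erefl (frac a s0)).
by exists u => //; rewrite !scalerA !scalerN e.
Qed.

Lemma faddE a s (s0 : s != 0) b t (t0 : t != 0) :
  fadd (frac a s0) (frac b t0) = frac (t *: a + s *: b) (mulf_neq0 s0 t0).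
Proof.
apply/eq_frac; have [u u0] := frac_repr (erefl (frac a s0)).
have [v v0] := frac_repr (erefl (frac b t0)).
move: (num _) (den _) (num _) (den _) => a' s' b' t' eb ea.
exists (u * v); first exact: mulf_neq0.
rewrite !scalerDr !scalerA; congr (_ + _).
  have -> : u * v * (s * t) * t' = v * t * t' * (u * s) by ring.
  by rewrite -scalerA ea scalerA; congr (_ *: _); ring.
have -> : u * v * (s * t) * s' = u * s * s' * (v * t) by ring.
by rewrite -scalerA eb scalerA; congr (_ *: _); ring.
Qed.

Lemma fmulE a s (s0 : s != 0) b t (t0 : t != 0) :
  fmul (frac a s0) (frac b t0) = frac (a * b) (mulf_neq0 s0 t0).
Proof.
apply/eq_frac; have [u u0] := frac_repr (erefl (frac a s0)).
have [v v0] := frac_repr (erefl (frac b t0)).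
move: (num _) (den _) (num _) (den _) => a' s' b' t' eb ea.
exists (u * v); first exact: mulf_neq0.
rewrite !scalerA; have -> : u * v * (s * t) = (u * s) * (v * t) by ring.
rewrite -scalerA scalerAr eb scalerAl ea -scalerAl -scalerAr scalerA.
by congr (_ *: _); ring.
Qed.

Lemma fracP (q : fractions) : exists a s (s0 : s != 0), q = frac a s0.
Proof.
by exists (num q), (den q), (den_neq0 q); rewrite frac_num_den.
Qed.

Let eq_frac1 a s (s0 : s != 0) b t (t0 : t != 0) :
  t *: a = s *: b -> frac a s0 = frac b t0.
Proof. by move=> e; apply/eq_frac; exists 1; rewrite ?oner_neq0 ?e. Qed.

Fact faddA : associative fadd.
Proof.
move=> p q r; have [a [s [s0 ->]]] := fracP p; have [b [t [t0 ->]]] := fracP q.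
have [c [u [u0 ->]]] := fracP r; rewrite !faddE; apply: eq_frac1.
rewrite !scalerDr !scalerA addrA.
by congr (_ *: _ + _ *: _ + _ *: _); ring.
Qed.

Fact faddC : commutative fadd.
Proof.
move=> p q; have [a [s [s0 ->]]] := fracP p; have [b [t [t0 ->]]] := fracP q.
by rewrite !faddE; apply: eq_frac1; rewrite mulrC addrC.
Qed.

Fact fadd0 : left_id fzero fadd.
Proof.
move=> p; have [a [s [s0 ->]]] := fracP p; rewrite faddE; apply: eq_frac1.
by rewrite scaler0 add0r scale1r mul1r.
Qed.

Fact faddN : left_inverse fzero fopp fadd.
Proof.
move=> p; have [a [s [s0 ->]]] := fracP p; rewrite foppE faddE.
by apply: eq_frac1; rewrite scalerN addNr !scaler0.
Qed.

HB.instance Definition _ :=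
  GRing.isZmodule.Build fractions faddA faddC fadd0 faddN.

Fact fmulA : associative fmul.
Proof.
move=> p q r; have [a [s [s0 ->]]] := fracP p; have [b [t [t0 ->]]] := fracP q.
have [c [u [u0 ->]]] := fracP r; rewrite !fmulE; apply: eq_frac1.
by rewrite !mulrA.
Qed.

Fact fmul1 : left_id fone fmul.
Proof.
move=> p; have [a [s [s0 ->]]] := fracP p; rewrite fmulE; apply: eq_frac1.
by rewrite !mul1r.
Qed.

Fact fmulr1 : right_id fone fmul.
Proof.
move=> p; have [a [s [s0 ->]]] := fracP p; rewrite fmulE; apply: eq_frac1.
by rewrite !mulr1.
Qed.

Fact fmulDl : left_distributive fmul fadd.
Proof.
move=> p q r; have [a [s [s0 ->]]] := fracP p; have [b [t [t0 ->]]] := fracP q.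
have [c [u [u0 ->]]] := fracP r; rewrite !(faddE, fmulE); apply: eq_frac1.
rewrite mulrDl !scalerDr -!scalerAl !scalerA.
by congr (_ *: _ + _ *: _); ring.
Qed.

Fact fmulDr : right_distributive fmul fadd.
Proof.
move=> p q r; have [a [s [s0 ->]]] := fracP p; have [b [t [t0 ->]]] := fracP q.
have [c [u [u0 ->]]] := fracP r; rewrite !(faddE, fmulE); apply: eq_frac1.
rewrite mulrDr !scalerDr -!scalerAr !scalerA.
by congr (_ *: _ + _ *: _); ring.
Qed.

HB.instance Definition _ :=
  GRing.Zmodule_isPzRing.Build fractions fmulA fmul1 fmulr1 fmulDl fmulDr.

Lemma frac_mulE a s (s0 : s != 0) b t (t0 : t != 0) :
  frac a s0 * frac b t0 = frac (a * b) (mulf_neq0 s0 t0).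
Proof. exact: fmulE. Qed.

Lemma frac_addE a s (s0 : s != 0) b t (t0 : t != 0) :
  frac a s0 + frac b t0 = frac (t *: a + s *: b) (mulf_neq0 s0 t0).
Proof. exact: faddE. Qed.

End Fractions.

(* Main.v *)
Require Import Defs.
From mathcomp Require Import all_boot all_algebra.
From mathcomp Require Import classical_sets cardinality.
From mathcomp Require Import finmap zify.
From mathcomp.multinomials Require Import monalg.

(** Substituting suitable powers of one unit for the variables turns the Laurent
    identity into an ordinary non-zero polynomial [f] over [R] that vanishes at
    every unit of [A]: the constant term survives because every other word gets
    a non-zero exponent ([LPI_units_poly]).  It is enough to exploit [f].

    As [R] is infinite, a polynomial expression in a parameter [r] of [R] that
    vanishes for all [r] has all its coefficients killed by one non-zero scalar,
    a Vandermonde determinant that depends only on the degree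
    ([vanishing_poly]).  If [x * x = y * y = 0], then
    [(1 + r *: x) * (1 + r *: y)] is a unit for all [r]; the coefficient
    of [r ^+ (2 * n)] in its value under [f] is the leading coefficient of [f]
    times [(x * y) ^+ n], where [n] is the degree of [f].  So a non-zero scalar, the same for all such [x] and [y],
    kills [(x * y) ^+ n] ([square_zero_mul_nilpotent]).

    Let [b * c = 0] and let [a] be nilpotent, [u = 1 + a].  For every [z] the
    element [c * z * b] and its conjugate by [u] have square zero.  Modulo
    induction on the nilpotency index of [a], which removes
    [b * a ^+ 2 * u^-1 * c], the elements [b * u * c] and [b * u^-1 * c] are
    [g] and [- g] with [g = b * a * c], so that the power above becomes a power of [g * z].  Thus a
    multiple of [g] generates a right ideal that is nil of bounded index.
    Levitzki's theorem says that such a right ideal of a semiprime ring is zero;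
    over [R] it is obtained up to a non-zero scalar by linearising the identity
    [x ^+ m = 0] ([bounded_nil_right_ideal]).  Hence a non-zero scalar kills
    [b * a * c] ([nilpotent_sandwich]).

    Allowing such scalars all along makes both conclusions consequences of this
    one fact about [A], even when [A] has torsion.  If [A] is torsion-free the
    scalar can be dropped.  In the ring of fractions it is invertible: for an
    idempotent [e], clearing denominators in [e], [e * q * (1 - e)] and [1 - e]
    gives [b], [a] and [c] in [A], whence [e * q * (1 - e) = 0]; this and the same
    for [1 - e] say that [e] is central. *)

Set Implicit Arguments.
Unset Strict Implicit.
Unset Printing Implicit Defensive.

Import GRing.Theory.

Local Open Scope classical_set_scope.
Local Open Scope ring_scope.

(** * Coefficients of expressions that vanish on an infinite domain *)

Section Vandermonde.
Variable R : idomainType.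
Hypothesis R_infinite : infinite_set [set: R].

Lemma nonzero_Vandermonde n :
  exists a : 'rV[R]_n, \det (Vandermonde n a) != 0.
Proof.
have [B _ sB] := infinite_set_fset n R_infinite.
exists (\row_i (B : seq R)`_i); rewrite det_Vandermonde.
apply/prodf_neq0 => i _; apply/prodf_neq0 => j ij; rewrite !mxE subr_eq0.
rewrite nth_uniq ?fset_uniq ?(leq_trans (ltn_ord _) sB) //.
by rewrite neq_ltn ij orbT.
Qed.

(** With [W] the Vandermonde matrix of [n] distinct points, [W * adj W] is
    [\det W] times the identity, so [\det W] replaces the division that solves
    the linear system over a field.  The scalar is chosen before the module, so
    it can be used uniformly. *)
Lemma vanishing_coef n : exists2 d : R, d != 0 &
  forall (V : lmodType R) (g : 'I_n -> V),
    (forall r, \sum_(i < n) r ^+ i *: g i = 0) -> forall i, d *: g i = 0.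
Proof.
have [a a0] := nonzero_Vandermonde n; exists (\det (Vandermonde n a)) => //.
move=> V g g0 k; set W := Vandermonde n a.
have -> : \det W *: g k = \sum_i (W *m \adj W) i k *: g i.
  rewrite mul_mx_adj (bigD1 k) //= mxE eqxx mulr1n big1 ?addr0 // => i ik.
  by rewrite mxE (negPf ik) scale0r.
under eq_bigr => i _ do rewrite mxE scaler_suml.
rewrite exchange_big big1 //= => j _.
under eq_bigr => i _ do rewrite mxE mulrC -scalerA.
by rewrite -scaler_sumr g0 scaler0.
Qed.

Lemma vanishing_poly n : exists2 d : R, d != 0 &
  forall (A : algType R) (p : {poly A}), (size p <= n)%N ->
    (forall r : R, p.[r%:A] = 0) -> forall i, d *: p`_i = 0.
Proof.
have [d d0 dP] := vanishing_coef n; exists d => // A p sp p0 i.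
have [lt_in|/(leq_trans sp) le_pi] := ltnP i n; last first.
  by rewrite nth_default ?scaler0.
apply: (dP A (fun j : 'I_n => p`_j) _ (Ordinal lt_in)) => r.
rewrite -[RHS](p0 r) (horner_coef_wide _ sp); apply: eq_bigr => j _.
by rewrite exprZn expr1n mulr_algr.
Qed.

End Vandermonde.

(** * Polynomials over a non-commutative algebra *)

Section HornerScalar.
Variables (R : comNzRingType) (A : algType R).

(** Evaluation over a non-commutative algebra is multiplicative at the points
    [r%:A], as they are central. *)
Lemma hornerM_scalar (p q : {poly A}) (r : R) :
  (p * q).[r%:A] = p.[r%:A] * q.[r%:A].
Proof. by rewrite hornerM_comm // /comm_poly mulr_algl mulr_algr. Qed.

Lemma hornerX_scalar (p : {poly A}) (r : R) n :
  (p ^+ n).[r%:A] = p.[r%:A] ^+ n.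
Proof. by rewrite horner_exp_comm // /comm_poly mulr_algl mulr_algr. Qed.

End HornerScalar.

Lemma size_exp_bound (A : nzRingType) (p : {poly A}) m k :
  (size p <= m.+1)%N -> (size (p ^+ k) <= (m * k).+1)%N.
Proof.
move=> sp; apply: leq_trans (size_poly_exp_leq _ _) _.
by rewrite ltnS leq_mul2r -subn1 leq_subLR sp orbT.
Qed.

(** Stated for a bound [m] on the degree because the leading coefficient may be
    nilpotent, and then the degree of [p ^+ k] is not [m * k]. *)
Lemma coef_exp_top (A : nzRingType) (p : {poly A}) m k :
  (size p <= m.+1)%N -> (p ^+ k)`_(m * k) = p`_m ^+ k.
Proof.
move=> sp; elim: k => [|k IH]; first by rewrite muln0 coef1.
have lt_m : (m < (m * k.+1).+1)%N by rewrite ltnS mulnS leq_addr.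
rewrite !exprS coefM (bigD1 (Ordinal lt_m)) //= {1}mulnS addKn IH.
rewrite big1 ?addr0 // => i; rewrite -val_eqE /= neq_ltn => /orP[im|mi].
  rewrite [X in _ * X]nth_default ?mulr0 //.
  rewrite (leq_trans (size_exp_bound _ sp)) // ltn_subRL [ltnRHS]mulnS.
  by rewrite ltn_add2r.
by rewrite nth_default ?mul0r // (leq_trans sp).
Qed.

(** Among the words with a single factor [z] in the expansion of
    [(x + z) ^+ k.+1], all but [z * x ^+ k] contain [x * z]. *)
Lemma coef1_exp (A : nzRingType) (x z : A) k : x * z = 0 ->
  ((x%:P + z *: 'X) ^+ k.+1)`_1 = z * x ^+ k.
Proof.
move=> xz.
have c0 j : ((x%:P + z *: 'X) ^+ j)`_0 = x ^+ j.
  elim: j => [|j IH]; first by rewrite coef1.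
  rewrite exprS coefM big_ord_recl big_ord0 /= addr0 IH coefD coefC coefZ.
  by rewrite coefX /= mulr0 addr0 exprS.
elim: k => [|k IH].
  by rewrite !expr1 coefD coefC coefZ coefX /= add0r.
rewrite exprS coefM !big_ord_recl big_ord0 /= addr0 /bump /= IH c0.
rewrite !coefD !coefC !coefZ !coefX /= mulr0 mulr1 addr0 add0r.
by rewrite mulrA xz mul0r add0r.
Qed.

(** * Units and powers *)

Lemma mulrX_shift (A : pzRingType) (x y : A) k :
  (x * y) ^+ k * x = x * (y * x) ^+ k.
Proof.
elim: k => [|k IH]; rewrite ?mul1r ?mulr1 // exprSr -!mulrA mulrA IH.
by rewrite exprSr !mulrA.
Qed.

Lemma square_zero_unit (A : unitRingType) (x : A) :
  x * x = 0 -> 1 + x \is a GRing.unit.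
Proof.
move=> xx; apply/unitrP; exists (1 - x).
by rewrite !(mulrDl, mulrDr, mulNr, mulrN, mul1r, mulr1) xx oppr0 !addr0
  addrK addrNK.
Qed.

Lemma nilpotent_unit (A : unitRingType) (a : A) k :
  a ^+ k = 0 -> 1 + a \is a GRing.unit.
Proof.
move=> ak; apply/unitrP; exists (\sum_(i < k) (- a) ^+ i).
have e : (1 + a) * \sum_(i < k) (- a) ^+ i = 1.
  apply/oppr_inj; rewrite -mulNr opprD addrC -subrX1.
  by rewrite exprNn ak mulr0 add0r.
split=> //; rewrite -[RHS]e; apply/commr_sym/commr_sum => i _.
by apply/commrX/commrN/commr_sym/commrD; [apply: commr1|].
Qed.

(** * Products of two square-zero elements *)

Section UnitsPolynomial.
Variables (R : idomainType) (A : unitAlgType R) (f : {poly R}).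
Hypothesis R_infinite : infinite_set [set: R].
Hypothesis f0 : f != 0.
Hypothesis f_units :
  forall u : A, u \is a GRing.unit -> horner_alg u f = 0.

(** For degree [0] the conclusion reads [d *: 1 = 0]: then all of [A] is killed
    by [d], and the later arguments go through unchanged. *)
Lemma square_zero_mul_nilpotent :
  exists (d : R) (n : nat), d != 0 /\
    forall x y : A, x * x = 0 -> y * y = 0 -> d *: (x * y) ^+ n = 0.
Proof.
pose n := (size f).-1.
have sf : size f = n.+1 by rewrite prednK // size_poly_gt0.
have [d d0 dP] := vanishing_poly R_infinite (2 * n).+1.
exists (d * lead_coef f), n; split=> [|x y xx yy].
  by rewrite mulf_neq0 ?lead_coef_eq0.
pose U : {poly A} := (1 + x *: 'X) * (1 + y *: 'X).
have sL (z : A) : (size (1 + z *: 'X)%R <= 2)%N.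
  rewrite (leq_trans (size_polyD _ _)) // geq_max size_poly1 /=.
  by rewrite (leq_trans (size_scale_leq _ _)) ?size_polyX.
have sU : (size U <= 3)%N.
  rewrite (leq_trans (size_polyMleq _ _)) //.
  by rewrite -subn1 leq_subLR (leq_add (sL x) (sL y)).
have U2 : U`_2 = x * y.
  rewrite coefM !big_ord_recr big_ord0 /= !coefD !coefZ !coefX !coef1 /=.
  by rewrite !(mulr0, mulr1, addr0, add0r, mul0r).
(* [G] is the value of [f] at [U], with coefficients moved into [A]. *)
pose G := \sum_(i < n.+1) (f`_i)%:A *: U ^+ i.
have sG : (size G <= (2 * n).+1)%N.
  apply: (leq_trans (size_sum _ _ _)); apply/bigmax_leqP => i _.
  rewrite (leq_trans (size_scale_leq _ _)) //.
  rewrite (leq_trans (size_exp_bound _ sU)) //.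
  by rewrite ltnS leq_mul2l -ltnS ltn_ord.
have /(dP _ _ sG)/(_ (2 * n)%N) : forall r : R, G.[r%:A] = 0.
  move=> r; pose u := (1 + r *: x) * (1 + r *: y).
  have uU : u \is a GRing.unit.
    by rewrite unitrMl !square_zero_unit // -scalerAl -scalerAr
      ?xx ?yy !scaler0.
  rewrite -[RHS](f_units uU) -[f in RHS]coefK sf poly_def.
  rewrite linear_sum /= horner_sum; apply: eq_bigr => i _.
  rewrite hornerZ hornerX_scalar /U hornerM_scalar.
  rewrite !hornerD !hornerZ hornerX !mulr_algr -polyC1 !hornerC.
  by rewrite linearZ /= rmorphXn /= horner_algX.
rewrite coef_sum big_ord_recr /= big1 => [|i _]; last first.
  rewrite coefZ [X in _ * X]nth_default ?mulr0 //.
  rewrite (leq_trans (size_exp_bound _ sU)) //.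
  by rewrite ltn_mul2l /=.
rewrite add0r coefZ coef_exp_top // U2 mulr_algl.
by rewrite /lead_coef -/n scalerA.
Qed.

End UnitsPolynomial.

(** * Nil right ideals of bounded index in semiprime algebras *)

Section Semiprime.
Variable A : nzRingType.
Hypothesis A_semiprime : semiprime A.

(** In place of the ideal generated by [v] one can use a larger one: [L] is the left annihilator of
    [A * v], and the elements of [L] annihilated by all of [L] form an ideal [I]
    with [I * I = 0].  The hypothesis puts [v] in [I]. *)
Lemma semiprime_elt (v : A) : (forall a, v * a * v = 0) -> v = 0.
Proof.
move=> vAv.
pose L := [set x : A | forall a, x * a * v = 0].
pose I := [set y : A | L y /\ forall x, L x -> x * y = 0].
apply: (A_semiprime (I := I)); last first.
- by split=> // x /(_ 1); rewrite mulr1.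
- exists 2 => x xI; rewrite !big_ord_recl big_ord0 mulr1.
  by case: (xI (lift ord0 ord0)) => _; apply; case: (xI ord0).
have LM x b : L x -> L (x * b).
  by move=> Lx a; rewrite -(mulrA x) Lx.
split.
- by split=> [a|x _]; rewrite ?mul0r ?mulr0.
- move=> x y [Lx Kx] [Ly Ky]; split=> [a|z Lz].
    by rewrite !mulrDl Lx Ly addr0.
  by rewrite mulrDr Kx ?Ky ?addr0.
- move=> a x [Lx Kx]; split; split.
  + by move=> b; rewrite -2!(mulrA a) Lx mulr0.
  + by move=> z Lz; rewrite mulrA Kx //; apply: LM.
  + exact: LM.
  + by move=> z Lz; rewrite mulrA Kx // mul0r.
Qed.

End Semiprime.

Section BoundedNil.
Variables (R : idomainType) (A : algType R).
Hypothesis R_infinite : infinite_set [set: R].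
Hypothesis A_semiprime : semiprime A.

(** Levitzki's theorem up to a scalar.  For [x] in the right ideal and any [t],
    the element [z = x ^+ m.+1 * t] satisfies [x * z = 0], so the coefficient of
    [r] in [(x + r *: z) ^+ m.+2 = 0] is [x ^+ m.+1 * t * x ^+ m.+1]; being killed
    by [d] for all [t], it forces [d *: x ^+ m.+1 = 0].  Scaling the ideal by [d]
    lowers the index. *)
Lemma bounded_nil_right_ideal m (w : A) :
  (forall y, (w * y) ^+ m = 0) -> exists2 d : R, d != 0 & d *: w = 0.
Proof.
elim: m w => [|[|m] IH] w wP.
- by have /eqP := wP 0; rewrite expr0 oner_eq0.
- by exists 1; rewrite ?oner_neq0 // scale1r -[w]mulr1 -[_ * _]expr1 wP.
have [d d0 dP] := vanishing_poly R_infinite m.+3.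
have dxm y : d *: (w * y) ^+ m.+1 = 0.
  set x := w * y; apply: (semiprime_elt A_semiprime) => t.
  pose z := x ^+ m.+1 * t.
  have xz : x * z = 0 by rewrite /z mulrA -exprS wP mul0r.
  pose p := (x%:P + z *: 'X) ^+ m.+2.
  have sp : (size p <= m.+3)%N.
    rewrite -[m.+2]mul1n size_exp_bound // (leq_trans (size_polyD _ _)) //.
    rewrite geq_max (leq_trans (size_polyC_leq1 _)) //=.
    by rewrite (leq_trans (size_scale_leq _ _)) ?size_polyX.
  have p0 r : p.[r%:A] = 0.
    rewrite hornerX_scalar hornerD hornerC hornerZ hornerX.
    (* the whole pencil stays in the right ideal, where powers vanish *)
    suff -> : x + z * r%:A = w * (y + y * x ^+ m * t * r%:A) by apply: wP.
    by rewrite mulrDr /z exprS /x !mulrA.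
  have := dP _ _ sp p0 1; rewrite coef1_exp // /z => dz.
  by rewrite -scalerAl -scalerAr -scalerAl dz scaler0.
have [|d' d'0 e] := IH (d *: w).
  by move=> y; rewrite -scalerAl exprZn [d ^+ _]exprSr -scalerA dxm scaler0.
by exists (d' * d); rewrite ?mulf_neq0 // -scalerA.
Qed.

End BoundedNil.

(** * Nilpotent elements between annihilating elements *)

Section NilpotentBetween.
Variables (R : idomainType) (A : unitAlgType R) (f : {poly R}).
Hypothesis R_infinite : infinite_set [set: R].
Hypothesis A_semiprime : semiprime A.
Hypothesis f0 : f != 0.
Hypothesis f_units :
  forall u : A, u \is a GRing.unit -> horner_alg u f = 0.

(** The square-zero elements are [s = c * x * b] and its conjugate [t] by
    [1 + a].  The third hypothesis is what makes [b * (1 + a)^-1 * c] equal to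
    [- (b * a * c)]. *)
Lemma square_sandwich (b c a : A) :
    b * c = 0 -> 1 + a \is a GRing.unit ->
    b * (a ^+ 2 * (1 + a)^-1) * c = 0 ->
  exists2 d : R, d != 0 & d *: (b * a * c) = 0.
Proof.
move=> bc uU ba2c; set u := 1 + a in uU ba2c *; set g := b * a * c.
have [d [n [d0 dP]]] := square_zero_mul_nilpotent R_infinite f0 f_units.
have buc : b * u * c = g by rewrite /u mulrDr mulr1 mulrDl bc add0r.
have bvc : b * u^-1 * c = - g.
  have -> : u^-1 = 1 - a + a ^+ 2 * u^-1.
    apply: (mulIr uU); rewrite mulVr // mulrDl -mulrA mulVr // mulr1 expr2.
    by rewrite /u !(mulrDl, mulrDr, mulNr, mul1r, mulr1) addrA addrK addrNK.
  by rewrite !(mulrDl, mulrDr, mulNr, mulrN, mulr1) bc ba2c add0r addr0.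
suff gP x : ((d *: g) * x) ^+ (n + n).+1 = 0.
  have [e e0 eP] := bounded_nil_right_ideal R_infinite A_semiprime gP.
  by exists (e * d); rewrite ?mulf_neq0 // -scalerA.
pose s := c * x * b; pose t := u * s * u^-1.
have ss : s * s = 0 by rewrite /s -!mulrA (mulrA b) bc !(mul0r, mulr0).
have tt : t * t = 0.
  suff -> : t * t = u * (s * s) * u^-1 by rewrite ss mulr0 mul0r.
  by rewrite /t !mulrA mulrVK.
have st : s * t = c * (x * g * x * (b * u^-1)).
  by rewrite /s /t /s -buc !mulrA.
have := dP _ _ ss tt; rewrite st => h.
have {h} : d *: (b * u^-1 * ((c * (x * g * x * (b * u^-1))) ^+ n * c) * x) = 0.
  by rewrite scalerAl scalerAr scalerAl h mul0r mulr0 mul0r.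
(* moving [c] through the power turns each factor [b * u^-1 * c] into [- g] *)
rewrite mulrX_shift mulrA bvc -[x * g * x * _ * c]mulrA bvc.
rewrite mulrN -[x * g * x * g]mulrA -expr2 exprNn -exprM -signr_odd.
rewrite mul2n -addnn.
have gx : g * (x * g) ^+ (n + n) * x = (g * x) ^+ (n + n).+1.
  by rewrite -mulrX_shift -mulrA -exprSr.
rewrite mulr_sign -scalerAl exprZn [d ^+ _]exprSr -scalerA -gx => h.
suff -> : d *: (g * (x * g) ^+ (n + n) * x) = 0 by rewrite scaler0.
move: h; case: (odd n); rewrite ?(mulrN, mulNr, scalerN) ?opprK // => h.
by apply: oppr_inj; rewrite h oppr0.
Qed.

(** Induction on the nilpotency index: [a ^+ 2 * (1 + a)^-1] has a smaller index
    than [a], and the scalar obtained for it is absorbed into [b]. *)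
Lemma nilpotent_sandwich (b c a : A) :
    b * c = 0 -> nilpotent a ->
  exists2 d : R, d != 0 & d *: (b * a * c) = 0.
Proof.
move=> bc [k]; elim: k a => [|[|k] IH] a ak.
- by have /eqP := ak; rewrite expr0 oner_eq0.
- by exists 1; rewrite ?oner_neq0 // -[a]expr1 ak mulr0 mul0r scaler0.
have uU := nilpotent_unit ak.
have [|d d0 dP] := IH (a ^+ 2 * (1 + a)^-1).
  have au : GRing.comm (a ^+ 2) (1 + a)^-1.
    apply/commrV/commrD; first exact: commr1.
    exact/commr_sym/commrX.
  rewrite exprMn_comm // -exprM mul2n -addnn addnS -addSn exprD ak.
  by rewrite !mul0r.
have dbc : d *: b * c = 0 by rewrite -scalerAl bc scaler0.
have dba2c : d *: b * (a ^+ 2 * (1 + a)^-1) * c = 0 by rewrite -!scalerAl.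
have [e e0 eP] := square_sandwich dbc uU dba2c.
by exists (e * d); rewrite ?mulf_neq0 // -scalerA !(scalerAl d).
Qed.

End NilpotentBetween.

(** * From a Laurent identity to a polynomial vanishing at the units *)

Lemma common_nonroot (s : seq {poly int}) :
  (forall p, p \in s -> p != 0) ->
  exists N : int, forall p, p \in s -> p.[N] != 0.
Proof.
move=> s0; pose q := \prod_(p <- s) p.
have q0 : q != 0.
  by rewrite prodf_seq_neq0; apply/allP => p /s0.
have /allPn[N _ qN] : ~~ all (root q) [seq Posz i | i <- iota 0 (size q)].
  apply/negP => /(max_poly_roots q0).
  rewrite map_inj_uniq ?iota_uniq; last by move=> i j [].
  by rewrite size_map size_iota ltnn => /(_ isT).
exists N => p ps; apply: contraNneq qN => pN.
by rewrite rootE horner_prod prodf_seq_eq0; apply/hasP; exists p; rewrite ?pN.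
Qed.

Section OneVariable.
Variable m : nat.

(** The exponent sums of a word, packed as coefficients: a word with some
    non-zero exponent sum becomes a non-zero polynomial, and substituting the
    powers [u ^ (N ^+ i)] for the variables evaluates it at [N]. *)
Definition exponent_poly (w : free_group m) : {poly int} :=
  \sum_(x <- word w) (if x.2 then 1 else -1) *: 'X^(x.1).

Lemma coef_exponent_poly w (j : 'I_m) :
  (exponent_poly w)`_j = exponent_sum j w.
Proof.
rewrite /exponent_sum [RHS]big_mkcond coef_sum; apply: eq_bigr => x _.
by rewrite coefZ coefXn eq_sym val_eqE; case: eqP; rewrite ?mulr1 ?mulr0.
Qed.

Lemma word_eval_exponents (A : unitRingType) (u : A) (N : int) w :
  u \is a GRing.unit ->
  word_eval (fun i : 'I_m => u ^ (N ^+ i)) w = u ^ (exponent_poly w).[N].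
Proof.
move=> uU; rewrite /word_eval /exponent_poly horner_sum.
elim: (word w) => [|x s IH]; first by rewrite !big_nil.
rewrite !big_cons exprzDr // IH hornerZ hornerXn /letter_eval.
by case: x.2; rewrite ?mul1r // mulN1r invr_expz.
Qed.

End OneVariable.

(** The variables are sent to powers of [u].  Distinct words may receive
    the same exponent and cancel, but the trivial word is the only one with
    exponent zero, so its coefficient persists. *)
Lemma LPI_units_poly (R : idomainType) (A : unitAlgType R) :
  units_satisfy_LPI A ->
  exists2 f : {poly R}, f != 0 &
    forall u : A, u \is a GRing.unit -> horner_alg u f = 0.
Proof.
case=> m [P [[P1 _ Pexp] [_ PA]]].
have [|N Nk] := @common_nonroot
    [seq exponent_poly w | w <- msupp P & w != 1%g].
  move=> p /mapP[w]; rewrite mem_filter => /andP[w1 wP] ->.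
  have [j] := Pexp w wP w1; rewrite -coef_exponent_poly.
  by apply: contraNneq => ->; rewrite coef0.
pose k (w : free_group m) := (exponent_poly w).[N].
have k0 w : w \in msupp P -> w != 1%g -> k w != 0.
  by move=> wP w1; apply/Nk/map_f; rewrite mem_filter w1.
(* multiplying by [u ^+ M] makes all exponents non-negative *)
pose M := (\sum_(w <- msupp P) `|k w|)%N.
pose e w := absz (k w + M%:Z).
have kM w : w \in msupp P -> (e w)%:Z = k w + M%:Z.
  move=> wP; have le_kM : (`|k w| <= M)%N.
    by rewrite /M (big_rem w wP) /= leq_addr.
  by rewrite /e gez0_abs //; lia.
pose f : {poly R} := \sum_(w <- msupp P) P@_w *: 'X^(e w).
exists f.
  suff fM : f`_M = P@_1%g.
    move: P1; rewrite -mcoeff_neq0 -fM; apply: contraNneq => ->.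
    by rewrite coef0.
  rewrite coef_sum (big_rem _ P1) /= coefZ coefXn /e /k /exponent_poly.
  rewrite big_nil horner0 add0r eqxx mulr1 big_seq big1 ?addr0 // => w.
  rewrite mem_rem_uniq ?fset_uniq // inE => /andP[w1 wP].
  rewrite coefZ coefXn -eqz_nat kM // eq_sym -subr_eq0 addrK.
  by rewrite (negPf (k0 _ wP w1)) mulr0.
move=> u uU; have /(congr1 (fun z => z * u ^+ M)) :=
  PA (fun i => u ^ (N ^+ i)) (fun i => unitrXz _ uU).
rewrite mul0r /laurent_eval mmapE mulr_suml => <-.
rewrite linear_sum big_seq [RHS]big_seq; apply: eq_bigr => w wP.
rewrite linearZ /= rmorphXn /= horner_algX word_eval_exponents // -/(k w).
by rewrite mulr_algl -!scalerAl mul1r (exprnP _ (e w)) (exprnP _ M) kM //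
  exprzDr.
Qed.

(** * Idempotents of the ring of fractions *)

Lemma frac_eq0 (R : idomainType) (A : algType R) (a : A) (s : R)
    (s0 : s != 0) :
  Defs.frac a s0 = 0 <-> exists2 d : R, d != 0 & d *: a = 0.
Proof.
split=> [/eq_frac[d d0]|[d d0 da]].
  by rewrite scale1r !scaler0 => da; exists d.
by apply/eq_frac; exists d; rewrite // scale1r !scaler0.
Qed.

Theorem corollary3p3 (R : idomainType) (A : unitAlgType R)
    (R_infinite : infinite_set [set: R])
    (A_semiprime : semiprime A)
    (A_LPI : units_satisfy_LPI A) :
  (forall e : fractions A, e * e = e -> forall q : fractions A, e * q = q * e)
  /\
  (torsion_free A ->
   forall b c : A, b * c = 0 ->
   forall a : A, nilpotent a -> b * a * c = 0).
Proof.
have [f f0 fU] := LPI_units_poly A_LPI.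
have key := nilpotent_sandwich R_infinite A_semiprime f0 fU.
split; last first.
  move=> A_tf b c bc a /(key _ _ _ bc)[d d0 /A_tf[d00|//]].
  by rewrite d00 eqxx in d0.
have idem_corner (e : fractions A) (q : fractions A) :
    e * e = e -> e * q * (1 - e) = 0.
  have [p [s [s0 ->]]] := fracP e; have [x [t [t0 ->]]] := fracP q.
  rewrite frac_mulE => /eq_frac[r1 r10 pp1].
  (* Equality of fractions holds up to a scalar factor, hence [r]: [p] behaves
     as [s] times an idempotent once multiplied by [r]. *)
  have [r r0 pp] : exists2 r, r != 0 & r *: (p * p) = (r * s) *: p.
    exists (r1 * s); first exact: mulf_neq0.
    by rewrite -[LHS]scalerA pp1 !scalerA mulrA.
  have -> : 1 - Defs.frac p s0 = Defs.frac (s%:A - p) s0.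
    rewrite -[- _]/(fopp _) foppE frac_addE; apply/eq_frac.
    by exists 1; rewrite ?oner_neq0 // !scale1r mul1r.
  rewrite !frac_mulE; apply/frac_eq0; set c := s%:A - p.
  have pc : r *: p * c = 0.
    by rewrite mulrBr mulr_algr -scalerAl pp scalerA mulrC subrr.
  have cp : r *: (c * p) = 0.
    by rewrite mulrBl mulr_algl scalerBr pp scalerA subrr.
  have cc : r *: (c * c) = (r * s) *: c.
    by rewrite {1}/c mulrBl mulr_algl scalerBr scalerA (scalerAl r p) pc subr0.
  (* the factor [r] makes the middle element square to zero in [A] itself *)
  have [|d d0 dP] := key _ _ (p * x * (r *: c)) pc.
    exists 2; rewrite expr2 -!mulrA mulrA (mulrA _ p) -scalerAl cp.
    by rewrite !(mul0r, mulr0).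
  exists (d * (r * s) * (r * s)); rewrite ?mulf_neq0 // -[RHS]dP.
  have <- : r *: (p * p) * x * (r *: (c * c)) = r *: p * (p * x * (r *: c)) * c.
    by rewrite -!(scalerAl, scalerAr) !mulrA.
  by rewrite pp cc -!(scalerAl, scalerAr) !scalerA !mulrA.
move=> e ee q; have e1 : (1 - e) * (1 - e) = 1 - e.
  by rewrite mulrBr mulr1 mulrBl mul1r ee subrr subr0.
have := idem_corner _ q ee; have := idem_corner _ q e1.
rewrite opprB addrCA subrr addr0 mulrBl mul1r mulrBl mulrBr mulr1.
by move=> /eqP; rewrite subr_eq0 => /eqP -> /eqP; rewrite subr_eq0 => /eqP.
Qed.
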